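(* Assume that $\lfloor (M_1+\dots+M_n)/p\rfloor = n-1$ (ample reduction). For $j=1,\dots,n-1$ put $w_j = M_j^{-1}e_j - M_{j+1}^{-1}e_{j+1}\in\mathbb{F}_p^n$; these form a basis of $S=\{c\in\mathbb{F}_p^n:\ \sum_i m_ic_i=0\}$. For $l=1,\dots,n-1$ write $I^{[l]}(z)=\sum_{j=1}^{n-1}c^l_j(z)\,w_j$ with $c^l_j(z)\in\mathbb{F}_p[z_1,\dots,z_n]$. Then the square matrix $c(z)=(c^l_j(z))_{l,j=1,\dots,n-1}$ has nonzero determinant, and $$\det c(z)=\frac{\Gamma_{\mathbb{F}_p}(M_1+1)\cdots\Gamma_{\mathbb{F}_p}(M_n+1)}{\Gamma_{\mathbb{F}_p}(M_1+\dots+M_n-(n-1)p+1)}\prod_{1\le i<j\le n}(-1)^{M_j}(z_j-z_i)^{M_i+M_j-p}.$$ Equivalently, the constant factor equals $(-1)^{n-1}\frac{M_1!\cdots M_n!}{(M_1+\dots+M_n-(n-1)p)!}$ (reduced mod $p$).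
   Context: Let $p,q$ be prime numbers and $n$ a positive integer with $p>n\ge 2$ and $p>q$ (so $p$ is odd). Fix positive integers $m_1,\dots,m_n$ with $m_i<q$. For each $i$ let $M_i$ be the least positive integer with $M_i\equiv -m_i q^{-1}\pmod p$ (so $1\le M_i\le p-1$); in formulas over $\mathbb{F}_p$, $M_i$ denotes its residue. Let $e_1,\dots,e_n$ be the standard basis of $\mathbb{F}_p^n$. Put $\Phi_p(x,z)=\prod_{i=1}^n(x-z_i)^{M_i}$. For a positive integer $l$, $I^{[l]}(z)\in\mathbb{F}_p[z_1,\dots,z_n]^n$ is defined as the coefficient of $x^{lp-1}$ in the polynomial vector $\big(\Phi_p(x,z)/(x-z_1),\dots,\Phi_p(x,z)/(x-z_n)\big)$ (a polynomial in $x,z$ with coefficients in $\mathbb{F}_p^n$). All coefficient vectors of $I^{[l]}(z)$ lie in $S$, so the expansion in the $w_j$ exists. For an integer $1\le x\le p$, $\Gamma_{\mathbb{F}_p}(x)\in\mathbb{F}_p$ denotes the residue of $(-1)^{x-1}(x-1)!$. (Under the hypothesis all exponents $M_i+M_j-p$ are nonnegative and $0\le M_1+\dots+M_n-(n-1)p<p$.) *)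

(* Defs.v *)
From HB Require Import structures.
From mathcomp Require Import all_boot all_order all_algebra.
From mathcomp Require Import mpoly.
Set Implicit Arguments. Unset Strict Implicit. Unset Printing Implicit Defensive.
Import Order.TTheory GRing.Theory.
Local Open Scope ring_scope.

Definition Mres (p q m : nat) : 'F_p := - (m%:R) / (q%:R).

(* M = least positive integer congruent to -m q^{-1} mod p. *)
Definition Mnat (p q m : nat) : nat :=
  let r := nat_of_ord (Mres p q m) in if r == 0%N then p else r.

Definition GammaFp (p x : nat) : 'F_p := (-1) ^+ (x.-1) * (x.-1)`!%:R.

(* Phi_p(x,z)/(x - z_i) = prod_k (x - z_k)^(M_k - delta_{ik}), as a polynomial
   in x with coefficients in F_p[z_1..z_n]. *)
Definition Phi_div (p n : nat) (M : 'I_n -> nat) (i : 'I_n)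
  : {poly {mpoly 'F_p[n]}} :=
  \prod_(k < n) ('X - ('X_k)%:P) ^+ (M k - (k == i)).

Definition Ivec (p n : nat) (M : 'I_n -> nat) (l : nat) (i : 'I_n)
  : {mpoly 'F_p[n]} := (Phi_div p M i)`_(l * p - 1).

Definition wvec (p n : nat) (M : 'I_n -> nat) (j : 'I_(n.-1)) (i : 'I_n) : 'F_p :=
  (if nat_of_ord i == nat_of_ord j then (M i)%:R^-1 else 0)
  - (if nat_of_ord i == (nat_of_ord j).+1 then (M i)%:R^-1 else 0).

Definition is_expansion (p n : nat) (M : 'I_n -> nat)
  (c : 'M[{mpoly 'F_p[n]}]_(n.-1)) : Prop :=
  forall (l : 'I_(n.-1)) (i : 'I_n),
    Ivec p M (nat_of_ord l).+1 i = \sum_(j < n.-1) c l j * mpolyC n (wvec p M j i).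

Arguments Mres : clear implicits.
Arguments Mnat : clear implicits.
Arguments GammaFp : clear implicits.
Arguments Phi_div p {n} M i.
Arguments Ivec p {n} M l i.
Arguments wvec p {n} M j i.
Arguments is_expansion p {n} M c.

(* Main.v *)
(** The entries are c^l_j = coefficient of x^(lp-1) in the partial sum
    sum_(i <= j) M_i Phi/(x - z_i).  The determinant is computed by induction on
    the number of points, over a field K of characteristic p in which the z_i are
    distinct, the last point being replaced by a variable y.  Taking the
    coefficient of u^(p-1) after the substitution x = u + z_i is a combination of
    the rows in which the first one has coefficient 1, and it produces the factor
    (y - z_i)^(M_i + M_n - p).  The product of these factors has degree
    (n-2) M_n + r, where r = M_1 + ... + M_n - (n-1) p, which is also the sum of
    the degrees in y of the rows; so the cofactor is the determinant of the leading
    coefficients in y.  In that matrix the last column is zero except at the bottom,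
    because the full sum is the derivative of a polynomial, and deleting the last
    row and column leaves, up to signs, the matrix for n-1 points.  Wilson's theorem
    turns the resulting constants into factorials. *)
Require Import Defs.
From HB Require Import structures.
From mathcomp Require Import all_boot all_order all_algebra.
From mathcomp Require Import mpoly.
From mathcomp Require Import zify ring.
Import Order.TTheory GRing.Theory.
Local Open Scope ring_scope.

(** * Determinants of matrices of polynomials *)

(** Each Leibniz product takes one entry from every row, so the row bounds add up. The [d i] are
    only upper bounds: the matrix of coefficients may be singular. *)
Lemma det_coef_row_degree (R : comNzRingType) (n : nat) (A : 'M[{poly R}]_n)
    (d : 'I_n -> nat) :
  (forall i j, (size (A i j) <= (d i).+1)%N) ->
  (size (\det A) <= (\sum_i d i).+1)%N /\
  (\det A)`_(\sum_i d i)%N = \det (\matrix_(i, j) (A i j)`_(d i)).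
Proof.
move=> szA.
have prodP (F : 'I_n -> {poly R}) (s : seq 'I_n) :
    (forall i, (size (F i) <= (d i).+1)%N) ->
    (size (\prod_(i <- s) F i)%R <= (\sum_(i <- s) d i).+1)%N /\
    (\prod_(i <- s) F i)`_(\sum_(i <- s) d i)%N = \prod_(i <- s) (F i)`_(d i).
  move=> szF; elim: s => [|i s [IHs IHc]].
    by rewrite !big_nil size_poly1 coef1.
  rewrite !big_cons; split.
    by apply: leq_trans (size_polyMleq _ _) _; have := szF i; lia.
  (* In the convolution only the index [d i] survives; any other index exceeds one of the two degree
     bounds. *)
  rewrite coefM (bigD1 (inord (d i))) //= inordK ?ltnS ?leq_addr //.
  rewrite addKn IHc [X in _ + X]big1 ?addr0 // => k.
  rewrite -val_eqE /= inordK ?ltnS ?leq_addr // => neq_k.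
  have [ltkd|ledk] := ltnP k (d i).
    by rewrite [X in _ * X]nth_default ?mulr0 //; apply: leq_trans IHs _; lia.
  by rewrite nth_default ?mul0r //; apply: leq_trans (szF i) _; lia.
split.
  apply: leq_trans (size_sum _ _ _) _; apply/bigmax_leqP=> s _.
  have [sz _] := prodP (fun i => A i (perm.fun_of_perm s i)) (index_enum 'I_n) (fun i => szA i _).
  by rewrite -signr_odd; case: odd; rewrite ?mulN1r ?size_polyN ?mul1r.
rewrite coef_sum; apply: eq_bigr => s _.
have [_ co] := prodP (fun i => A i (perm.fun_of_perm s i)) (index_enum 'I_n) (fun i => szA i _).
rewrite -(rmorph_sign polyC) mulrC coefMC mulrC co.
by congr (_ * _); apply: eq_bigr => i _; rewrite mxE.
Qed.

(** Replacing row [i0] by the combination is left multiplication by a matrix [T] of determinant 1,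
    after which a whole row is divisible by [d]. *)
Lemma dvdp_det_row_comb (K : fieldType) (n : nat) (A : 'M[{poly K}]_n)
    (i0 : 'I_n) (c : 'I_n -> {poly K}) (d : {poly K}) :
  c i0 = 1 -> (forall j, d %| \sum_i c i * A i j) -> d %| \det A.
Proof.
move=> c1 dvd_row.
pose T : 'M[{poly K}]_n := \matrix_(i, j) (if i == i0 then c j else (i == j)%:R).
have detT : \det T = 1.
  rewrite (expand_det_col T i0) (bigD1 i0) //= big1 => [|i /negPf ne]; last first.
    by rewrite mxE ne mul0r.
  rewrite !mxE eqxx c1 mul1r addr0 /cofactor -signr_odd oddD addbb mul1r.
  rewrite (_ : row' _ _ = 1%:M) ?det1 //; apply/matrixP=> i j.
  by rewrite !mxE eq_sym (negPf (neq_lift _ _)) (inj_eq lift_inj).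
rewrite -[\det A]mul1r -detT -det_mulmx (expand_det_row _ i0).
apply: (big_ind (fun x => d %| x)) => [||j _]; [exact: dvdp0 | exact: dvdp_add |].
apply: dvdp_mulr; rewrite mxE.
by under eq_bigr => k _ do rewrite mxE eqxx.
Qed.

(** * Coefficients of powers of linear polynomials *)

(** By Frobenius, (X + a)^k = (X^p + a^p)^(k / p) (X + a)^(k mod p). Modulo X^p the first factor is
    constant, and the second is monic of degree at most p - 1. *)
Lemma coef_Xn_add_poly_pchar (R : comNzRingType) (p : nat) (a : R) (k : nat) :
  p \in [pchar R] ->
  (('X + a%:P) ^+ k)`_p.-1 =
    if (k %% p == p.-1)%N then a ^+ (k %/ p * p) else 0.
Proof.
move=> charRp; have p_pr := pcharf_prime charRp; have p_gt0 := prime_gt0 p_pr.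
have charPp : p \in [pchar {poly R}] by rewrite pchar_poly.
have -> : ('X + a%:P) ^+ k = ('X^p + (a ^+ p)%:P) ^+ (k %/ p) * ('X + a%:P) ^+ (k %% p).
  rewrite {1}(divn_eq k p) exprD mulnC exprM exprDn_pchar ?rmorphXn //.
  by rewrite pnatE.
(* The factorization of a difference of powers gives the constant term plus an explicit multiple of
   X^p. *)
have -> : ('X^p + (a ^+ p)%:P) ^+ (k %/ p) = (a ^+ (k %/ p * p))%:P
    + 'X^p * \sum_(i < k %/ p) ('X^p + (a ^+ p)%:P) ^+ ((k %/ p).-1 - i) * (a ^+ p)%:P ^+ i.
  have := subrXX ('X^p + (a ^+ p)%:P) (a ^+ p)%:P (k %/ p).
  rewrite addrK => /eqP; rewrite subr_eq => /eqP ->.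
  by rewrite addrC -rmorphXn -exprM mulnC.
rewrite mulrDl -mulrA coefD coefXnM ltn_predL p_gt0 addr0 coefCM.
have lt_kp : (k %% p < p)%N by rewrite ltn_mod.
rewrite -[a%:P]opprK -polyCN.
have [->|ne] := eqVneq (k %% p)%N p.-1; last first.
  by rewrite nth_default ?mulr0 // size_exp_XsubC; lia.
have /monicP := monic_exp p.-1 (monicXsubC (- a)).
by rewrite /lead_coef size_exp_XsubC => ->; rewrite mulr1.
Qed.

Lemma coef_shift_poly_pchar (R : comNzRingType) (p n : nat) (a : R) (f : {poly R}) :
  p \in [pchar R] -> (size f < n.+1 * p)%N ->
  (f \Po ('X + a%:P))`_p.-1 = \sum_(l < n) a ^+ (l * p) * f`_(l.+1 * p - 1).
Proof.
move=> charRp szf; have p_pr := pcharf_prime charRp; have p_gt0 := prime_gt0 p_pr.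
have szf' : (size f <= n.+1 * p)%N by exact: ltnW.
rewrite coef_comp_poly.
under eq_bigr => k _ do rewrite coef_Xn_add_poly_pchar //.
rewrite (big_ord_widen _ (fun k => f`_k * (if (k %% p == p.-1)%N then a ^+ (k %/ p * p) else 0)) szf').
rewrite big_mkcond /=.
have -> : \sum_(i < n.+1 * p)
    (if (i < size f)%N then f`_i * (if (i %% p == p.-1)%N then a ^+ (i %/ p * p) else 0) else 0)
  = \sum_(i < n.+1 * p) (if (i %% p == p.-1)%N then a ^+ (i %/ p * p) * f`_i else 0).
  apply: eq_bigr => i _; case: ifP => [_|/negbT]; last rewrite -leqNgt => le.
    by case: ifP; rewrite ?mulr0 // mulrC.
  by rewrite nth_default // mulr0 if_same.
(* In each block of p consecutive indices only the last one is p - 1 modulo p. *)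
have step N : \sum_(i < N * p) (if (i %% p == p.-1)%N then a ^+ (i %/ p * p) * f`_i else 0)
   = \sum_(l < N) a ^+ (l * p) * f`_(l.+1 * p - 1).
  elim: N => [|N IHN]; first by rewrite mul0n !big_ord0.
  rewrite big_ord_recr /= -IHN mulSnr big_split_ord /=; congr (_ + _).
  rewrite -(prednK p_gt0) big_ord_recr /= big1 ?add0r => [|i _].
    rewrite prednK // modnMDl modn_small ?eqxx ?ltn_predL //.
    rewrite divnMDl // divn_small ?addn0 ?ltn_predL //.
    by congr (_ * f`_ _); lia.
  rewrite prednK // modnMDl modn_small; last by have := ltn_ord i; lia.
  by case: eqP => // eq; have := ltn_ord i; lia.
(* The block l = n drops out: its index (n+1)p - 1 is beyond the degree of [f], by the strict size
   bound. *)
rewrite step big_ord_recr /= [X in _ + _ * X]nth_default ?mulr0 ?addr0 //.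
by rewrite -ltnS subn1 (ltn_predK szf).
Qed.

(** A term contributing to x^s takes at most s - c factors x from (x - t)^m, hence at least c + m -
    s factors t. *)
Lemma dvdp_coef_XsubC_exp (K : fieldType) (t : {poly K}) (c m s : nat)
    (g : {poly {poly K}}) (e : nat) :
  (e + s <= c + m)%N ->
  t ^+ e %| ('X^c * g * ('X - t%:P) ^+ m)`_s.
Proof.
move=> le_es; rewrite coefM.
apply: (big_ind (fun x => t ^+ e %| x)) => [||j _]; [exact: dvdp0 | exact: dvdp_add |].
rewrite coefXnM; case: ltnP => [_|le_cj]; first by rewrite mul0r dvdp0.
apply: dvdp_mull; rewrite exprBn coef_sum.
apply: (big_ind (fun x => t ^+ e %| x)) => [||b _]; [exact: dvdp0 | exact: dvdp_add |].
rewrite coefMn -[X in _ %| X]mulr_natr dvdp_mulr // -rmorphXn coefMC.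
rewrite -(rmorph_sign polyC) coefCM coefXn.
have [eq|] := eqVneq (s - j)%N (m - b)%N; last by rewrite mulr0 mul0r dvdp0.
rewrite dvdp_mull // dvdp_exp2l //.
have := ltn_ord b; have := ltn_ord j; lia.
Qed.

(** With y the inner variable, y^b in (x - y)^m comes with x^(m - b), which leaves x^(s + b - m) to
    [f]. The guard rules out truncated subtractions. *)
Lemma coef_coef_mul_XsubX_exp (R : comNzRingType) (f : {poly R}) (m s b : nat) :
  (((map_poly polyC f * ('X - 'X%:P) ^+ m)`_s)`_b =
   if (b <= m <= s + b)%N then (-1) ^+ b * 'C(m, b)%:R * f`_(s + b - m) else 0).
Proof.
rewrite exprBn mulr_sumr !coef_sum.
have E (i : 'I_m.+1) : ((map_poly polyC f * ((-1) ^+ i * 'X^(m - i) * 'X%:P ^+ i *+ 'C(m, i)))`_s)`_b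
  = if (i == b :> nat) && (m <= s + b)%N then (-1) ^+ b * 'C(m, b)%:R * f`_(s + b - m) else 0.
  rewrite [in LHS]mulrnAr !coefMn mulrA -rmorphXn coefMC mulrCA -(rmorph_sign polyC) coefCM.
  have ltim := ltn_ord i.
  rewrite coefMXn; case: ltnP => [lt|leib].
    by rewrite mul0rn; case: eqP => //=; lia.
  rewrite -(rmorph_sign polyC) coefCM coefMXn.
  case: ltnP => [lt|le].
    rewrite coef0 mulr0 mul0rn; case: eqP => //= eqib.
    by case: ifP => //; lia.
  rewrite coef_map /= coefC.
  case: eqP => [eq|ne]; last by rewrite mulr0 mul0rn; case: eqP => //=; lia.
  have eqib : i = b :> nat by lia.
  rewrite eqib eqxx /= ifT; last by lia.
  rewrite -[LHS]mulr_natr mulrAC; congr (_ * _ * f`_ _); lia.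
rewrite (eq_bigr _ (fun i _ => E i)).
case: (leqP b m) => [lebm|ltmb]; last first.
  rewrite big1 //= => i _; case: eqP => //=; have := ltn_ord i; lia.
rewrite (bigD1 (Ordinal (lebm : b < m.+1)%N)) //= eqxx big1 ?addr0 // => i.
by rewrite -val_eqE /= => /negPf ->.
Qed.

(** * The master polynomial, its partial sums and their coefficient matrix *)

(** Indexing by [nat] lets the number of points vary in the induction, and an arbitrary ring allows
    points that are field elements or polynomials. *)
Definition master_quot {R : comNzRingType} (z : nat -> R) (M : nat -> nat)
    (n i : nat) : {poly R} :=
  \prod_(k < n) ('X - (z k)%:P) ^+ (M k - (k == i :> nat)).

Definition master_sum {R : comNzRingType} (z : nat -> R) (M : nat -> nat)
    (n j : nat) : {poly R} :=
  \sum_(i < j) master_quot z M n i *+ M i.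

(* There are n.+1 points; row l corresponds to I^[l.+1]. *)
Definition coef_mx {R : comNzRingType} (p : nat) (z : nat -> R) (M : nat -> nat)
    (n : nat) : 'M[R]_n :=
  \matrix_(l < n, j < n) (master_sum z M n.+1 j.+1)`_(l.+1 * p - 1).

Lemma map_master_quot (R S : comNzRingType) (phi : {rmorphism R -> S})
    (z : nat -> R) (M : nat -> nat) (n i : nat) :
  map_poly phi (master_quot z M n i) = master_quot (phi \o z) M n i.
Proof.
rewrite /master_quot rmorph_prod /=; apply: eq_bigr => k _.
by rewrite rmorphXn rmorphB /= map_polyX map_polyC.
Qed.

Lemma map_master_sum (R S : comNzRingType) (phi : {rmorphism R -> S})
    (z : nat -> R) (M : nat -> nat) (n j : nat) :
  map_poly phi (master_sum z M n j) = master_sum (phi \o z) M n j.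
Proof.
rewrite /master_sum rmorph_sum /=.
by under eq_bigr => i _ do rewrite rmorphMn /= map_master_quot.
Qed.

Lemma map_coef_mx (R S : comNzRingType) (phi : {rmorphism R -> S}) (p : nat)
    (z : nat -> R) (M : nat -> nat) (n : nat) :
  map_mx phi (coef_mx p z M n) = coef_mx p (phi \o z) M n.
Proof.
by apply/matrixP=> l j; rewrite !mxE -coef_map map_master_sum.
Qed.

Lemma eq_master_quot (R : comNzRingType) (z z' : nat -> R) (M : nat -> nat) (n i : nat) :
  (forall k, (k < n)%N -> z k = z' k) -> master_quot z M n i = master_quot z' M n i.
Proof. by move=> eqz; apply: eq_bigr => k _; rewrite eqz. Qed.

Lemma eq_master_sum (R : comNzRingType) (z z' : nat -> R) (M : nat -> nat) (n j : nat) :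
  (forall k, (k < n)%N -> z k = z' k) -> master_sum z M n j = master_sum z' M n j.
Proof. by move=> eqz; apply: eq_bigr => i _; rewrite (eq_master_quot _ z z'). Qed.

Lemma eq_coef_mx (R : comNzRingType) (p : nat) (z z' : nat -> R) (M : nat -> nat) (n : nat) :
  (forall k, (k < n.+1)%N -> z k = z' k) -> coef_mx p z M n = coef_mx p z' M n.
Proof. by move=> eqz; apply/matrixP=> l j; rewrite !mxE (eq_master_sum _ z z'). Qed.

(** The last point is not among those divided out, so its full power is a common factor; this
    isolates the dependence on [z n]. *)
Lemma master_sumS (R : comNzRingType) (z : nat -> R) (M : nat -> nat) (n j : nat) :
  (j <= n)%N ->
  master_sum z M n.+1 j = master_sum z M n j * ('X - (z n)%:P) ^+ M n.
Proof.
move=> le_jn; rewrite /master_sum mulr_suml; apply: eq_bigr => i _.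
rewrite mulrnAl /master_quot big_ord_recr /=.
by rewrite gtn_eqF ?subn0 //; apply: leq_trans (ltn_ord i) le_jn.
Qed.

Lemma master_sum_deriv (R : comNzRingType) (z : nat -> R) (M : nat -> nat) (n : nat) :
  master_sum z M n n = (\prod_(k < n) ('X - (z k)%:P) ^+ M k)^`().
Proof.
elim: n => [|n IHn]; first by rewrite /master_sum !big_ord0 derivC.
rewrite [in RHS]big_ord_recr /= derivM -IHn -master_sumS //.
rewrite /master_sum big_ord_recr /=; congr (_ + _).
rewrite deriv_exp derivB derivX derivC subr0 mul1r mulrnAr; congr (_ *+ _).
rewrite /master_quot big_ord_recr /= eqxx subn1; congr (_ * _).
by apply: eq_bigr => k _; rewrite ltn_eqF ?subn0.
Qed.

(** In a derivative the coefficient of x^(lp - 1) carries the factor lp. *)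
Lemma coef_master_sum_full (R : comNzRingType) (p : nat) (z : nat -> R)
    (M : nat -> nat) (n l : nat) :
  p \in [pchar R] -> (master_sum z M n n)`_(l.+1 * p - 1) = 0.
Proof.
move=> charRp; have p_gt0 := prime_gt0 (pcharf_prime charRp).
rewrite master_sum_deriv coef_deriv subn1 prednK ?muln_gt0 // mulrnA.
by rewrite -mulr_natr (pcharf0 charRp) mulr0.
Qed.

Lemma master_quot_monic (R : comNzRingType) (z : nat -> R) (M : nat -> nat) (n i : nat) :
  master_quot z M n i \is monic.
Proof. by apply: monic_prod => k _; rewrite monic_exp // monicXsubC. Qed.

Lemma size_prod_XsubC_exp (R : idomainType) (z : nat -> R) (e : nat -> nat) (n : nat) :
  size (\prod_(k < n) ('X - (z k)%:P) ^+ e k) = (\sum_(k < n) e k).+1.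
Proof.
elim: n => [|n IHn]; first by rewrite !big_ord0 size_poly1.
rewrite !big_ord_recr /= size_Mmonic ?monic_exp ?monicXsubC //.
  by rewrite IHn size_exp_XsubC addSn addnS.
by apply/monic_neq0/monic_prod => k _; rewrite monic_exp ?monicXsubC.
Qed.

Lemma size_master_quot (R : idomainType) (z : nat -> R) (M : nat -> nat) (n i : nat) :
  (i < n)%N -> (0 < M i)%N ->
  size (master_quot z M n i) = (\sum_(k < n) M k)%N.
Proof.
move=> lt_in Mi_gt0; pose e k := (M k - (k == i :> nat))%N.
rewrite (size_prod_XsubC_exp _ z e) (bigD1 (Ordinal lt_in)) //=.
rewrite [in RHS](bigD1 (Ordinal lt_in)) //= /e eqxx -addSn subn1 prednK //.
congr (_ + _)%N; apply: eq_bigr => k; rewrite -val_eqE /= => /negPf ->.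
by rewrite subn0.
Qed.

Lemma size_master_sum (R : idomainType) (z : nat -> R) (M : nat -> nat) (n j : nat) :
  (j <= n)%N -> (forall k, (k < n)%N -> 0 < M k)%N ->
  (size (master_sum z M n j) <= \sum_(k < n) M k)%N.
Proof.
move=> le_jn M_gt0; apply: leq_trans (size_sum _ _ _) _.
apply/bigmax_leqP=> i _; have lt_in := leq_trans (ltn_ord i) le_jn.
by rewrite -mulr_natr -polyC_natr mulrC mul_polyC (leq_trans (size_scale_leq _ _)) //
  size_master_quot ?M_gt0.
Qed.

Lemma lead_coef_master_sum (R : idomainType) (z : nat -> R) (M : nat -> nat) (n j : nat) :
  (j <= n)%N -> (forall k, (k < n)%N -> 0 < M k)%N ->
  (master_sum z M n j)`_(\sum_(k < n) M k).-1 = (\sum_(i < j) M i)%:R.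
Proof.
move=> le_jn M_gt0; rewrite coef_sum natr_sum; apply: eq_bigr => i _.
have lt_in := leq_trans (ltn_ord i) le_jn.
rewrite coefMn -(size_master_quot _ z M n i) ?M_gt0 //.
by rewrite -[_`__]/(lead_coef _) (monicP (master_quot_monic _ z M n i)).
Qed.

(** * Divisibility of the determinant by powers of differences *)

Lemma dvdp_coef_shift_master_sum (K : fieldType) (p : nat) (z : nat -> {poly K})
    (M : nat -> nat) (n i j : nat) :
  (0 < p)%N -> (i < n)%N -> (j <= n)%N -> (0 < M i)%N -> (p <= M i + M n)%N ->
  (z n - z i) ^+ (M i + M n - p) %| (master_sum z M n.+1 j \Po ('X + (z i)%:P))`_p.-1.
Proof.
move=> p_gt0 lt_in le_jn Mi_gt0 le_p; rewrite master_sumS // /master_sum mulr_suml rmorph_sum coef_sum.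
apply: (big_ind (fun x => (z n - z i) ^+ (M i + M n - p) %| x)) => [||k _];
  [exact: dvdp0 | exact: dvdp_add |].
rewrite /master_quot (bigD1 (Ordinal lt_in)) //= mulrnAl rmorphMn !rmorphM !rmorphXn /=.
rewrite !comp_polyB !comp_polyX !comp_polyC.
rewrite addrK coefMn -[X in _ %| X]mulr_natr dvdp_mulr //.
have -> : 'X + (z i)%:P - (z n)%:P = 'X - (z n - z i)%:P by rewrite polyCB; ring.
(* The power of u is [M i], or [M i - 1] in the summand divided by x - z_i; there the required
   inequality is an equality. *)
by apply: dvdp_coef_XsubC_exp; case: eqP; lia.
Qed.

Lemma dvdp_det_coef_mx (K : fieldType) (p : nat) (z : nat -> {poly K})
    (M : nat -> nat) (n i : nat) :
  p \in [pchar K] -> (i < n)%N -> (forall k, (k < n.+1)%N -> 0 < M k)%N ->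
  (p <= M i + M n)%N -> (\sum_(k < n.+1) M k < n.+1 * p)%N ->
  (z n - z i) ^+ (M i + M n - p) %| \det (coef_mx p z M n).
Proof.
move=> charKp lt_in M_gt0 le_p lt_sum.
have n_gt0 : (0 < n)%N by exact: leq_trans lt_in.
(* The weights z_i^(lp) are those produced by the shift x = u + z_i; row 0 has weight 1. *)
apply: (dvdp_det_row_comb _ _ _ (Ordinal n_gt0) (fun l => z i ^+ (l * p))) => [|j].
  by rewrite expr0.
under eq_bigr => l _ do rewrite mxE.
rewrite -(coef_shift_poly_pchar _ p n (z i)) ?pchar_poly //.
  apply: dvdp_coef_shift_master_sum => //; last by apply: M_gt0; rewrite ltnS ltnW.
  exact: prime_gt0 (pcharf_prime charKp).
by apply: leq_ltn_trans lt_sum; apply: size_master_sum => //; apply: ltnW; rewrite ltnS ltn_ord.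
Qed.

(** * The last point as a variable *)

(** Point n becomes the indeterminate y, the others constants; evaluation at [z n] recovers the
    given points. *)
Definition adjoin_var {K : nzRingType} (z : nat -> K) (n k : nat) : {poly K} :=
  if k == n then 'X else (z k)%:P.

Lemma adjoin_var_horner (K : comNzRingType) (z : nat -> K) (n : nat) :
  horner_eval (z n) \o adjoin_var z n =1 z.
Proof.
by move=> k; rewrite /= /horner_eval /adjoin_var; case: eqP => [->|_]; rewrite hornerE.
Qed.

Lemma coef_coef_mx_adjoin (K : comNzRingType) (p : nat) (z : nat -> K) (M : nat -> nat)
    (n b : nat) (l j : 'I_n) :
  (coef_mx p (adjoin_var z n) M n l j)`_b =
  if (b <= M n <= l.+1 * p - 1 + b)%N
  then (-1) ^+ b * 'C(M n, b)%:R * (master_sum z M n j.+1)`_(l.+1 * p - 1 + b - M n)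
  else 0.
Proof.
rewrite mxE master_sumS // {2}/adjoin_var eqxx.
rewrite (eq_master_sum _ _ (polyC \o z)); last first.
  by move=> k lt_kn; rewrite /adjoin_var ltn_eqF.
by rewrite -map_master_sum coef_coef_mul_XsubX_exp.
Qed.

Lemma size_coef_mx_adjoin (K : comNzRingType) (p : nat) (z : nat -> K) (M : nat -> nat)
    (n : nat) (l j : 'I_n) :
  (size (coef_mx p (adjoin_var z n) M n l j) <= (M n).+1)%N.
Proof.
by apply/leq_sizeP=> b ltb; rewrite coef_coef_mx_adjoin; case: ifP => //; lia.
Qed.

(* Only the last row has degree < M n in the last variable: the total degree of
   its entries is the excess of the exponents over n.+1 * p. *)
Lemma size_coef_mx_adjoin_last (K : idomainType) (p : nat) (z : nat -> K) (M : nat -> nat)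
    (n : nat) (j : 'I_n.+1) :
  (forall k, (k < n.+1)%N -> 0 < M k)%N -> 
  (size (coef_mx p (adjoin_var z n.+1) M n.+1 ord_max j)
     <= (\sum_(k < n.+2) M k - n.+1 * p).+1)%N.
Proof.
move=> M_gt0; apply/leq_sizeP=> b ltb; rewrite coef_coef_mx_adjoin; case: ifP => // le_b.
have szQ := size_master_sum _ z M n.+1 j.+1 (ltn_ord j) M_gt0.
rewrite nth_default ?mulr0 //; apply: leq_trans szQ _.
move: ltb; rewrite big_ord_recr /=; lia.
Qed.

Lemma dvdp_prod_coprime (K : fieldType) (n : nat) (z : nat -> K) (e : nat -> nat) (f : {poly K}) :
  (forall i j, (i < j < n)%N -> z i != z j) ->
  (forall i, (i < n)%N -> ('X - (z i)%:P) ^+ e i %| f) ->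
  \prod_(i < n) ('X - (z i)%:P) ^+ e i %| f.
Proof.
elim: n => [|n IHn] z_inj dvd_f; first by rewrite big_ord0 dvd1p.
rewrite big_ord_recr /= Gauss_dvdp ?dvd_f // ?IHn // => [i j ltijn|i ltin|].
- by apply: z_inj; lia.
- by apply: dvd_f; lia.
apply: (big_ind (fun g => coprimep g _)) => [|g h cg ch|i _].
- exact: coprime1p.
- by rewrite coprimepMl cg.
apply: coprimep_expl; apply: coprimep_expr; apply: coprimep_XsubC2.
by rewrite subr_eq0 eq_sym z_inj // ltn_ord ltnSn.
Qed.

Lemma det_block_last_col (R : comNzRingType) (n : nat) (A : 'M[R]_n.+1) :
  (forall l, l != ord_max -> A l ord_max = 0) ->
  \det A = A ord_max ord_max * \det (\matrix_(i < n, j < n) A (widen_ord (leqnSn n) i) (widen_ord (leqnSn n) j)).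
Proof.
move=> A0; rewrite (expand_det_col A ord_max) (bigD1 ord_max) //=.
rewrite big1 ?addr0 => [|l /A0 ->]; last by rewrite mul0r.
rewrite /cofactor -signr_odd oddD addbb mul1r; congr (_ * \det _).
apply/matrixP=> i j; rewrite !mxE.
have wE (k : 'I_n) : lift ord_max k = widen_ord (leqnSn n) k.
  by apply: val_inj; exact: lift_max.
by rewrite !wE.
Qed.

(** * Adding one point *)

(** The constant is the determinant of leading coefficients in y: the corner entry gives (-1)^r, the
    binomial and the sum of exponents, and each of the other n rows gives (-1)^m. *)
Lemma det_coef_mxS (K : fieldType) (p : nat) (z : nat -> K) (M : nat -> nat) (n : nat) :
  p \in [pchar K] ->
  (forall i j, (i < j < n.+1)%N -> z i != z j) ->
  (forall k, (k < n.+2)%N -> 0 < M k < p)%N ->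
  (n.+1 * p <= \sum_(k < n.+2) M k)%N ->
  let m := M n.+1 in let r := (\sum_(k < n.+2) M k - n.+1 * p)%N in
  \det (coef_mx p z M n.+1) =
    (-1) ^+ (n * m + r) * 'C(m, r)%:R * (\sum_(k < n.+1) M k)%:R
    * \det (coef_mx p z M n) * \prod_(i < n.+1) (z n.+1 - z i) ^+ (M i + m - p).
Proof.
move=> charKp z_inj M_bd le_sum m r.
have M_gt0 k : (k < n.+2)%N -> (0 < M k)%N by move/M_bd/andP=> [].
have p_gt0 : (0 < p)%N by exact: prime_gt0 (pcharf_prime charKp).
have sumM_lt N : (N <= n.+2)%N -> (\sum_(k < N) M k <= N * p.-1)%N.
  move=> leN; rewrite -[N in (N * _)%N]card_ord -sum_nat_const; apply: leq_sum => k _.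
  have := M_bd k (leq_trans (ltn_ord k) leN); lia.
have defr : (r + n.+1 * p = \sum_(k < n.+1) M k + m)%N.
  by rewrite subnK // big_ord_recr.
have lt_rm : (r < m)%N.
  by have := sumM_lt n.+1 (leqnSn _); move: defr p_gt0; clearbody r m; nia.
have sum_gt0 : (0 < \sum_(k < n.+1) M k)%N.
  by rewrite big_ord_recr ltn_addl // M_gt0.
(* The n exponents other than [M i] and m are below p, so a total of at least (n+1)p leaves at least
   p for [M i + m]. *)
have ge_p i : (i < n.+1)%N -> (p <= M i + m)%N.
  move=> lt_in; have := defr; rewrite (bigD1 (Ordinal lt_in)) //=.
  have : (\sum_(k < n.+1 | k != Ordinal lt_in) M k <= n * p)%N.
    apply: (@leq_trans (\sum_(k < n.+1 | k != Ordinal lt_in) p)).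
      by apply: leq_sum => k _; have := M_bd k (ltnW (ltn_ord k)); lia.
    by rewrite sum_nat_const; have := cardC1 (Ordinal lt_in); rewrite card_ord => ->.
  by move: (\sum_(k < n.+1 | _) M k)%N => S; clearbody r m; rewrite mulSn; lia.
pose y := adjoin_var z n.+1.
pose B := coef_mx p y M n.+1.
pose d (l : 'I_n.+1) := if l == ord_max then r else m.
have sum_d : (\sum_l d l = n * m + r)%N.
  rewrite big_ord_recr /= /d eqxx; congr (_ + _)%N.
  rewrite (eq_bigr (fun=> m)) ?sum_nat_const ?card_ord // => i _.
  by rewrite -val_eqE /= ltn_eqF.
have szB l j : (size (B l j) <= (d l).+1)%N.
  rewrite /d; case: eqP => [->|_]; last exact: size_coef_mx_adjoin.
  by apply: size_coef_mx_adjoin_last => k ltk; apply: M_gt0; lia.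
have [szdet lcdet] := det_coef_row_degree _ _ _ _ szB.
rewrite sum_d in szdet lcdet.
pose g := \prod_(i < n.+1) ('X - (z i)%:P) ^+ (M i + m - p).
have dvd_g : g %| \det B.
  apply: (dvdp_prod_coprime _ n.+1 z (fun i => M i + m - p)%N) => // i lt_in.
  have -> : 'X - (z i)%:P = y n.+1 - y i by rewrite /y /adjoin_var eqxx ltn_eqF.
  apply: dvdp_det_coef_mx; rewrite ?pchar_poly ?ge_p //.
  have := sumM_lt n.+2 (leqnn _); move: p_gt0; nia.
(* The exponents sum to (M_0 + ... + M_n) + (n+1)m - (n+1)p = nm + r, exactly the degree bound for
   the determinant. *)
have szg : size g = (n * m + r).+1.
  rewrite /g (size_prod_XsubC_exp _ z (fun i => M i + m - p)%N); congr _.+1.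
  have : (\sum_(i < n.+1) (M i + m - p) + n.+1 * p = \sum_(i < n.+1) M i + n.+1 * m)%N.
    rewrite -[in (n.+1 * p)%N](card_ord n.+1) -[in (n.+1 * m)%N](card_ord n.+1).
    rewrite -!sum_nat_const -!big_split /=; apply: eq_bigr => i _.
    by rewrite subnK // ge_p.
  move: defr; rewrite mulSn; lia.
have mon_g : g \is monic by apply: monic_prod => i _; rewrite monic_exp ?monicXsubC.
(* A multiple of the monic [g] of no larger degree is a scalar multiple, and the scalar is read off
   at the top degree. *)
have detB : \det B = (\det B)`_(n * m + r) *: g.
  have /dvdpP [q Eq] := dvd_g.
  have [q0|q_neq0] := eqVneq q 0; first by rewrite Eq q0 mul0r coef0 scale0r.
  have szq : (size q <= 1)%N.
    by move: szdet; rewrite Eq size_Mmonic // szg addnS /= -add1n leq_add2r.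
  rewrite Eq (size1_polyC szq) mul_polyC coefZ; congr (_ *: _).
  have := monicP mon_g; rewrite /lead_coef szg /= => ->; by rewrite mulr1.
have -> : \det (coef_mx p z M n.+1) = (\det B).[z n.+1].
  rewrite -[RHS]/(horner_eval _ _) -det_map_mx map_coef_mx; congr (\det _).
  by apply: eq_coef_mx => k _; rewrite adjoin_var_horner.
rewrite detB hornerZ lcdet; congr (_ * _); last first.
  by rewrite horner_prod; apply: eq_bigr => i _; rewrite !hornerE.
(* Above the corner, the coefficient of y^m is up to sign a coefficient of the full sum over the
   first n+1 points, which vanishes. *)
rewrite det_block_last_col => [|l ne_l]; last first.
  rewrite mxE coef_coef_mx_adjoin /d (negPf ne_l).
  case: ifP => // _; rewrite addnK /= coef_master_sum_full // mulr0 //.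
rewrite mxE /d eqxx coef_coef_mx_adjoin -/m.
(* In the corner, y^r selects the top coefficient of the full sum, equal to the sum of the
   exponents. *)
have -> : (n.+1 * p - 1 + r - m = (\sum_(k < n.+1) M k).-1)%N.
  by move: defr lt_rm p_gt0; clearbody r m; lia.
rewrite lead_coef_master_sum ?ifT //; last first.
- by move=> k ltk; apply: M_gt0; lia.
- by rewrite /=; apply/andP; split; [exact: ltnW | move: lt_rm p_gt0 defr sum_gt0; clearbody r m; lia].
have -> : (\matrix_(i < n, j < n)
     (\matrix_(i0, j0) (B i0 j0)`_(if i0 == ord_max then r else m))
        (widen_ord (leqnSn n) i) (widen_ord (leqnSn n) j))
   = (-1) ^+ m *: coef_mx p z M n.
  apply/matrixP=> i j; rewrite !mxE -[_ == _]/(i == n :> nat) (ltn_eqF (ltn_ord i)).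
  have := coef_coef_mx_adjoin _ p z M n.+1 m (widen_ord (leqnSn n) i) (widen_ord (leqnSn n) j).
  rewrite mxE => ->; rewrite -/m leqnn leq_addl binn mulr1 addnK //=.
rewrite detZ -exprM exprD [(m * n)%N]mulnC /=; ring.
Qed.

(** * Factorials modulo p and the closed formula over a field *)

Lemma natf_fact_neq0_pchar (K : fieldType) (p k : nat) :
  p \in [pchar K] -> (k < p)%N -> (k`!)%:R != 0 :> K.
Proof.
move=> charKp; elim: k => [|k IHk] lt_kp; first by rewrite fact0 oner_eq0.
rewrite factS natrM mulf_neq0 ?IHk ?(ltnW lt_kp) //.
by rewrite -(dvdn_pcharf charKp) gtnNdvd.
Qed.

(* Wilson's theorem, spread over the two factors k! and (p-k-1)!. *)
Lemma fact_compl_pchar (K : fieldType) (p k : nat) :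
  p \in [pchar K] -> (k < p)%N ->
  (k`!)%:R * ((p - k.+1)`!)%:R = (-1) ^+ k.+1 :> K.
Proof.
move=> charKp; have p_pr := pcharf_prime charKp.
elim: k => [|k IHk] lt_kp.
  have := Wilson (prime_gt1 p_pr); rewrite p_pr => /esym.
  rewrite (dvdn_pcharf charKp) -natr1 addr_eq0 => /eqP.
  by rewrite fact0 mul1r subn1 expr1.
have def : (p - k.+1 = (p - k.+2).+1)%N by lia.
have := IHk (ltnW lt_kp); rewrite def !factS !natrM => IH.
have eqp : (p - k.+2).+1%:R = - k.+1%:R :> K.
  by apply/eqP; rewrite -addr_eq0 -natrD -def subnK ?(pcharf0 charKp) // ltnW.
rewrite exprS mulN1r -IH eqp; ring.
Qed.

(** Induction on the number of points. With k = m - r - 1, the first n+1 exponents have excess r' =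
    p - k - 1 and sum to -(k+1) in K. Wilson turns 1 / r'! into a sign times k!, and C(m, r) (k+1)
    k! = m! / r! supplies the new factorials. *)
Lemma det_coef_mx (K : fieldType) (p : nat) (z : nat -> K) (M : nat -> nat) (n : nat) :
  p \in [pchar K] ->
  (forall i j, (i < j < n.+1)%N -> z i != z j) ->
  (forall k, (k < n.+1)%N -> 0 < M k < p)%N ->
  (n * p <= \sum_(k < n.+1) M k)%N ->
  \det (coef_mx p z M n) =
    (-1) ^+ n * (\prod_(i < n.+1) ((M i)`!)%:R)
      / ((\sum_(k < n.+1) M k - n * p)`!)%:R
    * \prod_(j < n.+1) \prod_(i < j)
        ((-1) ^+ M j * (z j - z i) ^+ (M i + M j - p)).
Proof.
move=> charKp; elim: n => [|n IHn] z_inj M_bd le_sum.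
  rewrite det_mx00 mul0n subn0 !big_ord1 big_ord0 mulr1 mul1r.
  rewrite divff // (natf_fact_neq0_pchar _ p) //.
  by case/andP: (M_bd 0%N isT).
have p_gt0 : (0 < p)%N by exact: prime_gt0 (pcharf_prime charKp).
rewrite det_coef_mxS //; last by move=> i j ltij; apply: z_inj; lia.
set m := M n.+1; set r := (_ - n.+1 * p)%N.
have defr : (r + n.+1 * p = \sum_(k < n.+1) M k + m)%N.
  by rewrite subnK // big_ord_recr.
have lt_sum : (\sum_(k < n.+1) M k <= n.+1 * p.-1)%N.
  rewrite -[in (n.+1 * _)%N](card_ord n.+1) -sum_nat_const; apply: leq_sum => k _.
  have := M_bd k (leqW (ltn_ord k)); lia.
have /andP [m_gt0 lt_mp] : (0 < m < p)%N by apply: M_bd.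
have lt_rm : (r < m)%N by move: defr p_gt0 lt_sum; clearbody r m; nia.
rewrite IHn; first last.
- by move: defr lt_mp; clearbody r m; rewrite mulSn; lia.
- by move=> k ltk; apply: M_bd; exact: leqW.
- by move=> i j /andP [ltij ltj]; apply: z_inj; rewrite ltij leqW.
set r' := (\sum_(k < n.+1) M k - n * p)%N.
have defr' : (r' = p - (m - r))%N.
  by rewrite /r'; move: defr lt_mp lt_rm; clearbody r m; rewrite mulSn; lia.
pose k := (m - r).-1.
have defk : (m - r = k.+1)%N by rewrite /k prednK // subn_gt0.
have ltkp : (k < p)%N by rewrite -defk; lia.
have sumE : (\sum_(k < n.+1) M k)%:R = - (m - r)%:R :> K.
  apply/eqP; rewrite -addr_eq0 -natrD.
  have -> : (\sum_(k < n.+1) M k + (m - r) = n.+1 * p)%N.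
    by move: defr lt_rm; clearbody r m; lia.
  by rewrite natrM (pcharf0 charKp) mulr0.
have wil := fact_compl_pchar K p k charKp ltkp.
rewrite defr' sumE defk in wil *.
have rn0 : (r`!)%:R != 0 :> K by apply: (natf_fact_neq0_pchar _ p) => //; lia.
have kn0 : (k`!)%:R != 0 :> K by apply: (natf_fact_neq0_pchar _ p).
have r'n0 : ((p - k.+1)`!)%:R != 0 :> K.
  by apply: (natf_fact_neq0_pchar _ p) => //; lia.
have binE : 'C(m, r)%:R * ((r`!)%:R * (k.+1%:R * (k`!)%:R)) = (m`!)%:R :> K.
  by rewrite -!natrM -factS -defk bin_fact // ltnW.
rewrite !(big_ord_recr n.+1) /= -/m.
rewrite [\prod_(i < n.+1) ((-1) ^+ m * _)]big_split /= prodr_const card_ord.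
set P1 := \prod_(i < n.+1) _; set P2 := \prod_(i < n.+1) _ ^+ _.
set P3 := \prod_(i < n.+1) _.
have invE : ((p - k.+1)`!%:R)^-1 = (k`!)%:R * (-1) ^+ k.+1 :> K.
  by apply: (mulIf r'n0); rewrite mulVf // mulrAC wil -expr2 sqrr_sign.
(* Each of the n+1 new differences carries (-1)^m; the exponents agree because m = r + k + 1. *)
have signE : (-1) ^+ m ^+ n.+1 = (-1) ^+ (n * m + r) * (-1) ^+ k.+1 :> K.
  rewrite -exprM -exprD; congr (_ ^+ _).
  by move: defk lt_rm; clearbody r m k; rewrite mulnS mulnC; lia.
rewrite -binE invE signE [(-1) ^+ n.+1]exprS.
move: (r`!%:R) rn0 (k.+1%:R) (k`!%:R) ('C(m, r)%:R) => a a_neq0 b c d.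
move: ((-1) ^+ (n * m + r)) ((-1) ^+ k.+1) ((-1) ^+ n) => s1 s2 s3.
by field.
Qed.


(** * Coordinates in the basis w_j *)

(** Weighted by M, w_j becomes e_j - e_(j+1), whose partial sums are 1 at j and 0 elsewhere. Partial
    sums are thus the functionals dual to the w_j. *)
Lemma sum_M_wvec (p n : nat) (M : 'I_n -> nat) (j : 'I_n.-1) (a : nat) :
  (forall i, (M i)%:R != 0 :> 'F_p) -> (a < n)%N ->
  \sum_(i < n | (i <= a)%N) (M i)%:R * wvec p M j i = (a == j :> nat)%:R.
Proof.
move=> M_neq0 lt_an; have lt_jn : (j.+1 < n)%N by rewrite -ltn_predRL.
have dlt (b : nat) : (b < n)%N ->
    \sum_(i < n | (i <= a)%N) (if i == b :> nat then 1 else 0) = (b <= a)%N%:R :> 'F_p.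
  move=> lt_bn; rewrite big_mkcond (bigD1 (Ordinal lt_bn)) //= eqxx big1 ?addr0.
    by case: ifP.
  by move=> i; rewrite -val_eqE /= => /negPf ->; rewrite if_same.
transitivity (\sum_(i < n | (i <= a)%N) (if i == j :> nat then 1 else 0)
    - \sum_(i < n | (i <= a)%N) (if i == j.+1 :> nat then 1 else 0) : 'F_p).
  rewrite -sumrB; apply: eq_bigr => i _; rewrite /wvec mulrBr.
  by congr (_ - _); case: ifP; rewrite ?mulr0 ?divff.
rewrite !dlt ?(ltnW lt_jn) //.
by case: (ltngtP a j) => _; rewrite ?subrr ?subr0.
Qed.

Lemma Ivec_master_quot (p n : nat) (M : 'I_n.+1 -> nat) (l : nat) (i : 'I_n.+1) :
  Ivec p M l i =
    (master_quot (fun k => 'X_(inord k)) (fun k => M (inord k)) n.+1 i)`_(l * p - 1).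
Proof.
rewrite /Ivec; suff -> : Phi_div p M i =
  master_quot (fun k => 'X_(inord k)) (fun k => M (inord k)) n.+1 i by [].
by apply: eq_bigr => k _; rewrite inord_val.
Qed.

Lemma master_sum_Ivec (p n : nat) (M : 'I_n.+1 -> nat) (l a : nat) :
  (a <= n)%N ->
  (master_sum (fun k => 'X_(inord k)) (fun k => M (inord k)) n.+1 a.+1)`_(l * p - 1)
  = \sum_(i < n.+1 | (i <= a)%N) Ivec p M l i *+ M i.
Proof.
move=> le_an; rewrite coef_sum.
rewrite (big_ord_widen n.+1 (fun i => (master_quot _ _ n.+1 i *+ M (inord i))`_(l * p - 1))) //.
by apply: eq_big => [//|i _]; rewrite coefMn Ivec_master_quot inord_val.
Qed.

(** The dual functionals determine [c]; conversely, differences of consecutive partial sums give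
    back the components. This yields both existence and uniqueness of the expansion. *)
Lemma is_expansion_iff (p n : nat) (M : 'I_n.+1 -> nat) (c : 'M[{mpoly 'F_p[n.+1]}]_n) :
  prime p -> (forall i, (0 < M i < p)%N) ->
  is_expansion p M c <->
  c = coef_mx p (fun k => 'X_(inord k)) (fun k => M (inord k)) n.
Proof.
move=> p_pr M_bd.
have charFp := pchar_Fp p_pr.
have charP : p \in [pchar {mpoly 'F_p[n.+1]}] by apply: (rmorph_pchar (@mpolyC n.+1 'F_p)).
have M_neq0 i : (M i)%:R != 0 :> 'F_p.
  by rewrite -(dvdn_pcharf charFp) gtnNdvd //; case/andP: (M_bd i).
split=> [exp_c | ->].
  apply/matrixP=> l j; rewrite mxE master_sum_Ivec 1?ltnW //.
  under eq_bigr => i _ do rewrite exp_c -mulr_natr mulr_suml.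
  rewrite exchange_big /=.
  transitivity (\sum_(k < n) c l k * mpolyC n.+1 (j == k :> nat)%:R).
    rewrite (bigD1 j) //= eqxx mpolyC1 mulr1 big1 ?addr0 // => k.
    by rewrite -val_eqE eq_sym => /negPf ->; rewrite mpolyC0 mulr0.
  apply: eq_bigr => k _; rewrite -(sum_M_wvec p n.+1 M k j M_neq0); last by rewrite ltnS ltnW.
  rewrite rmorph_sum mulr_sumr; apply: eq_bigr => i _.
  by rewrite -mulrA; congr (_ * _); rewrite rmorphM /= mulrC rmorph_nat.
move=> l i.
pose S a := (master_sum (fun k => 'X_(inord k)) (fun k => M (inord k)) n.+1 a)`_(l.+1 * p - 1)
  : {mpoly 'F_p[n.+1]}.
(* These boundary values make the difference formula hold at i = 0 and i = n, where only one basis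
   vector has a nonzero component. The second says that I^[l] lies in S. *)
have S0 : S 0%N = 0 by rewrite /S /master_sum big_ord0 coef0.
have Sn : S n.+1 = 0 by exact: coef_master_sum_full.
have SS : S i.+1 = S i + Ivec p M l.+1 i *+ M i.
  by rewrite /S /master_sum big_ord_recr /= coefD coefMn Ivec_master_quot inord_val.
have sumS (a : nat) : (a <= n)%N ->
    \sum_(j < n) (if j.+1 == a then S j.+1 else 0) = S a.
  case: a => [_|a lt_an]; first by rewrite S0 big1.
  rewrite (bigD1 (Ordinal lt_an)) //= eqxx big1 ?addr0 // => j.
  by rewrite -val_eqE /= eqSS => /negPf ->.
have sumS' (a : nat) : (a <= n)%N ->
    \sum_(j < n) (if j == a :> nat then S j.+1 else 0) = S a.+1.
  rewrite leq_eqVlt => /orP [/eqP ->|lt_an].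
    by rewrite Sn big1 // => j _; rewrite ltn_eqF.
  rewrite (bigD1 (Ordinal lt_an)) //= eqxx big1 ?addr0 // => j.
  by rewrite -val_eqE /= => /negPf ->.
have -> : Ivec p M l.+1 i = (S i.+1 - S i) * mpolyC n.+1 (M i)%:R^-1.
  rewrite SS addrC addKr -[Ivec _ _ _ _ *+ _]mulr_natr -(rmorph_nat (@mpolyC n.+1 'F_p)) -mulrA -rmorphM /=.
  by rewrite divff ?mpolyC1 ?mulr1.
have le_in : (i <= n)%N by rewrite -ltnS.
rewrite -(sumS' i le_in) -(sumS i le_in) -sumrB mulr_suml; apply: eq_bigr => j _.
rewrite mxE -/(S j.+1) /wvec [j.+1 == i]eq_sym [(j : nat) == i]eq_sym.
rewrite rmorphB mulrBl mulrBr /=.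
by congr (_ - _); case: ifP; rewrite ?mpolyC0 ?mulr0 ?mul0r.
Qed.

(** * Bounds on the exponents and the determinant formula over F_p *)

(** Both m and q are units modulo p, so the residue is nonzero and the fallback value p in [Mnat] is
    not taken. *)
Lemma Mnat_bounds (p q m : nat) :
  prime p -> prime q -> (q < p)%N -> (0 < m < q)%N -> (0 < Mnat p q m < p)%N.
Proof.
move=> p_pr q_pr lt_qp /andP [m_gt0 lt_mq].
have charFp := pchar_Fp p_pr.
have neq0 (k : nat) : (0 < k < p)%N -> k%:R != 0 :> 'F_p.
  by case/andP=> k_gt0 lt_kp; rewrite -(dvdn_pcharf charFp) gtnNdvd.
have r_neq0 : Mres p q m != 0.
  rewrite /Mres mulf_neq0 ?oppr_eq0 ?invr_eq0 // neq0 ?m_gt0 ?(ltn_trans lt_mq) //.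
  by rewrite prime_gt0.
have ltr : (Mres p q m < p)%N by rewrite -[X in (_ < X)%N](card_Fp p_pr) card_ord.
have r_gt0 : (0 < Mres p q m)%N by rewrite lt0n; apply: contra r_neq0 => /eqP r0; apply/eqP/val_inj.
by rewrite /Mnat /= gtn_eqF // r_gt0.
Qed.

Lemma mpolyX_sub_neq0 (R : nzRingType) (n : nat) (i j : 'I_n) :
  i != j -> 'X_j - 'X_i != 0 :> {mpoly R[n]}.
Proof.
move=> ne_ij; apply/eqP => /(congr1 (mcoeff U_(j)%MM)).
rewrite mcoeffB !mcoeffX mcoeff0 eqxx; case: (U_(i)%MM =P U_(j)%MM) => [eqU|_].
  by have := (mnmP _ _).1 eqU i; rewrite !mnm1E eqxx eq_sym (negPf ne_ij).
by move/eqP; rewrite subr0 oner_eq0.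
Qed.

Theorem theorem7p2 (p q n : nat) (m : 'I_n -> nat)
  (hp : prime p) (hq : prime q) (hn2 : (2 <= n)%N) (hpn : (n < p)%N) (hpq : (q < p)%N)
  (hm_pos : forall i, (0 < m i)%N) (hm_lt : forall i, (m i < q)%N)
  (hample : ((\sum_(i < n) Mnat p q (m i)) %/ p = n.-1)%N) :
  let M := fun i : 'I_n => Mnat p q (m i) in
  (exists c : 'M[{mpoly 'F_p[n]}]_(n.-1), is_expansion p M c) /\
  (forall c : 'M[{mpoly 'F_p[n]}]_(n.-1), is_expansion p M c ->
     \det c != 0 /\
     \det c =
       mpolyC n ((\prod_(i < n) GammaFp p (M i).+1)
                 / GammaFp p ((\sum_(i < n) M i) - n.-1 * p).+1)
       * \prod_(i < n) \prod_(j < n | (i < j)%N)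
           (mpolyC n ((-1) ^+ M j) * ('X_j - 'X_i) ^+ (M i + M j - p))).
Proof.
case: n m hn2 hpn hm_pos hm_lt hample => [//|n] m n_gt0 lt_np m_gt0 m_lt ample M.
have M_bd i : (0 < M i < p)%N by apply: Mnat_bounds; rewrite ?m_gt0 ?m_lt.
have p_gt0 := prime_gt0 hp.
have le_sum : (n * p <= \sum_(i < n.+1) M i)%N.
  by rewrite -leq_divRL // ample.
have lt_sum : (\sum_(i < n.+1) M i < n.+1 * p)%N.
  by rewrite -ltn_divLR // ample.
pose Mn k := M (inord k).
have MnE (i : 'I_n.+1) : Mn i = M i by rewrite /Mn inord_val.
pose X k : {mpoly 'F_p[n.+1]} := 'X_(inord k).
split; first by exists (coef_mx p X Mn n); apply/is_expansion_iff.
move=> c /(is_expansion_iff _ _ _ _ hp M_bd) ->.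
set s := (_ - n.+1.-1 * p)%N.
set D := _ * \prod_(i < _) _.
have charFp := pchar_Fp hp.
have Gamma_neq0 k : (k < p)%N -> GammaFp p k.+1 != 0.
  by move=> lt_kp; rewrite mulf_neq0 ?signr_eq0 ?(natf_fact_neq0_pchar _ p).
have lt_sp : (s < p)%N by move: lt_sum; rewrite /s /= mulSn; lia.
have D_neq0 : D != 0.
  rewrite mulf_neq0 //.
    rewrite mpolyC_eq0 mulf_neq0 ?invr_eq0 ?Gamma_neq0 //.
    by apply/prodf_neq0 => i _; rewrite Gamma_neq0 //; case/andP: (M_bd i).
  apply/prodf_neq0 => i _; apply/prodf_neq0 => j lt_ij.
  rewrite mulf_neq0 ?mpolyC_eq0 ?signr_eq0 // expf_neq0 // mpolyX_sub_neq0 //.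
  by rewrite -val_eqE ltn_eqF.
suff detE : \det (coef_mx p X Mn n) = D by rewrite detE.
(* In the fraction field the variables are distinct points of a field of characteristic p, so the
   field formula applies; [tofrac] is injective, so the identity descends. *)
pose K := {fraction {mpoly 'F_p[n.+1]}}.
pose phi : {rmorphism 'F_p -> K} :=
  @tofrac {mpoly 'F_p[n.+1]} \o @mpolyC n.+1 'F_p.
have charK : p \in [pchar K] by apply: (rmorph_pchar phi).
apply/eqP; rewrite -tofrac_eq -det_map_mx map_coef_mx (det_coef_mx _ p) //; first last.
- by under eq_bigr => i _ do rewrite MnE.
- by move=> k _; apply: M_bd.
- move=> i j /andP [lt_ij lt_jn]; rewrite /= tofrac_eq eq_sym -subr_eq0.
  apply: mpolyX_sub_neq0; rewrite -val_eqE /= !inordK ?ltn_eqF //.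
  exact: ltn_trans lt_jn.
under [X in _ / (X - _)`!%:R]eq_bigr => i _ do rewrite MnE.
rewrite -/s /D rmorphM /=; apply/eqP; congr (_ * _).
  (* The Gamma signs leave (-1)^(M_0 + ... + M_n - s) = (-1)^(np), which is (-1)^n since p > 2 is
     odd. *)
  have -> : \prod_(i < n.+1) GammaFp p (M i).+1 / GammaFp p s.+1
      = (-1) ^+ n * (\prod_(i < n.+1) ((M i)`!)%:R) / (s`!)%:R.
    have odd_p : odd p.
      by case: (even_prime hp) => // p2; move: n_gt0 lt_np; rewrite p2; case: (n) => [|[]].
    have sum_s : (\sum_(i < n.+1) M i = s + n * p)%N by rewrite subnK.
    rewrite /GammaFp /= big_split /= -expr_sum sum_s exprD.
    have -> : (-1) ^+ (n * p) = (-1) ^+ n :> 'F_p.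
      by rewrite mulnC exprM -signr_odd odd_p expr1.
    rewrite invfM -[((-1) ^+ s)^-1]exprVn invrN1.
    move: (\prod_(i < n.+1) _) => P.
    transitivity ((-1) ^+ s * (-1) ^+ s * ((-1) ^+ n * P / (s`!)%:R)); first by ring.
    by rewrite -expr2 sqrr_sign mul1r.
  rewrite -[RHS]/(phi _) fmorph_div rmorphM rmorph_sign rmorph_prod rmorph_nat.
  by under eq_bigr => i _ do rewrite MnE; under [in RHS]eq_bigr => i _ do rewrite rmorph_nat.
rewrite rmorph_prod /=; under [RHS]eq_bigr => i _ do rewrite rmorph_prod /=.
(* The field formula has the larger index outermost, the theorem the smaller one. *)
rewrite [RHS](exchange_big_dep xpredT) //=; apply: eq_bigr => j _.
rewrite (big_ord_widen n.+1 (fun i => (-1) ^+ Mn j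
  * (tofrac (X j) - tofrac (X i)) ^+ (Mn i + Mn j - p)) (ltnW (ltn_ord j))).
apply: eq_bigr => i _; rewrite /X !MnE !inord_val tofracM tofracXn tofracB.
by congr (_ * _); rewrite -[RHS]/(phi _) rmorph_sign.
Qed.
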